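(* Let $\frac12<\alpha<1$ and $\mu^*:=5/6$. A local, analytic curve $\varepsilon\mapsto(\varphi(\varepsilon),\mu(\varepsilon))\in C^\alpha_{\mathrm{even}}(\mathbb{S})\times\mathbb{R}_{>0}$ of nontrivial KdV solutions with $D_\varepsilon\varphi(0)=\cos(x)$ bifurcates from the trivial solution curve $\mu\mapsto(0,\mu)$ at $(0,\mu^* )$.
   Context: $\mathbb{S}$ is the unit circle; functions on $\mathbb{S}$ are identified with $2\pi$-periodic functions on $\mathbb{R}$. $C^\alpha_{\mathrm{even}}(\mathbb{S})$ is the Banach space of real-valued, even, $\alpha$-Hölder continuous functions on $\mathbb{S}$. A KdV solution is a pair $(\varphi,\mu)$, with $\varphi$ $2\pi$-periodic, satisfying $(1-\mu)\varphi+\varphi^2+\frac16\varphi''=0$; it is trivial if $\varphi=0$. A local curve is one defined for $\varepsilon$ in a neighborhood of $0$, with $(\varphi(0),\mu(0))$ the bifurcation point and nontrivial points for $\varepsilon\ne0$. *)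

(* Defs.v *)
From HB Require Import structures.
From mathcomp Require Import all_boot all_order all_algebra.
From mathcomp Require Import all_classical all_reals all_analysis.
From mathcomp Require Import lra.

Set Implicit Arguments.
Unset Strict Implicit.
Unset Printing Implicit Defensive.

Import Order.TTheory GRing.Theory Num.Theory.
Import numFieldNormedType.Exports.

Local Open Scope classical_set_scope.
Local Open Scope ring_scope.

Section holder_even.
Context {R : realType}.
Implicit Types (a x y : R) (f g : R -> R^o).

Definition abs_values f : set R := [set `|f x| | x in [set: R]].

Definition holder_quotients a f : set R :=
  [set q | exists x y, x != y /\ q = `|f x - f y| / `|x - y| `^ a].

(* Functions on the circle are 2 pi-periodic functions on the line. For such
   functions and a > 0, taking the supremum of the Hölder quotients over all
   pairs of reals is the same as using the arc-length distance of the circle,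
   and boundedness of [f] follows from that of the quotients; it is required
   so that the norm below is a norm for every real [a]. *)
Definition holder_even_prop a f : Prop :=
  [/\ forall x, f (- x) = f x,
      forall x, f (x + 2 * pi) = f x,
      has_ubound (abs_values f) &
      has_ubound (holder_quotients a f)].

Definition holder_even_pred a : {pred R -> R^o} :=
  fun f => `[< holder_even_prop a f >].

Lemma abs_valuesP f C : ubound (abs_values f) C <-> forall x, `|f x| <= C.
Proof.
split=> [H x|H _ [x _ <-]]; last exact: H.
by apply: H; exists x.
Qed.

Lemma holder_quotientsP a f C : ubound (holder_quotients a f) C <->
  forall x y, x != y -> `|f x - f y| <= C * `|x - y| `^ a.
Proof.
have p0 x y : x != y -> 0 < `|x - y| `^ a.
  by move=> xy; rewrite powR_gt0// normr_gt0 subr_eq0.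
split=> [H x y xy|H _ [x [y [xy ->]]]].
  by rewrite -ler_pdivrMr ?p0//; apply: H; exists x, y.
by rewrite ler_pdivrMr ?p0// H.
Qed.

Lemma holder_even_submod_closed a : submod_closed (holder_even_pred a).
Proof.
split=> [|k f g /asboolP[fe fp [A /abs_valuesP fA] [B /holder_quotientsP fB]]
             /asboolP[ge gp [C /abs_valuesP gC] [D /holder_quotientsP gD]]].
  apply/asboolP; split=> //.
    by exists 0; apply/abs_valuesP => x; rewrite normr0.
  exists 0; apply/holder_quotientsP => x y _.
  by rewrite subr0 normr0 mul0r.
apply/asboolP; split=> [x|x||].
- by change (k * f (- x) + g (- x) = k * f x + g x); rewrite fe ge.
- by change (k * f (x + 2 * pi) + g (x + 2 * pi) = k * f x + g x); rewrite fp gp.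
- exists (`|k| * A + C); apply/abs_valuesP => x.
  change (`|k * f x + g x| <= `|k| * A + C).
  by rewrite (le_trans (ler_normD _ _))// normrM lerD// ler_wpM2l.
- exists (`|k| * B + D); apply/holder_quotientsP => x y xy.
  change (`|k * f x + g x - (k * f y + g y)| <=
    (`|k| * B + D) * `|x - y| `^ a).
  rewrite opprD addrACA -mulrBr (le_trans (ler_normD _ _))// normrM.
  by rewrite mulrDl -mulrA lerD ?ler_wpM2l// ?fB ?gD.
Qed.

HB.instance Definition _ a :=
  GRing.isSubmodClosed.Build R (R -> R^o) (holder_even_pred a)
    (holder_even_submod_closed a).

Record holder_even a := HolderEven {
  holder_fun :> R -> R^o;
  _ : holder_fun \in holder_even_pred a }.

HB.instance Definition _ a := [isSub for @holder_fun a].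
HB.instance Definition _ a := [Choice of holder_even a by <:].
HB.instance Definition _ a := [SubChoice_isSubLmodule of holder_even a by <:].

Definition holder_norm a (f : holder_even a) : R :=
  sup (abs_values f) + sup (holder_quotients a f).

Lemma holder_evenP a (f : holder_even a) : holder_even_prop a f.
Proof. by case: f => f /= /asboolP. Qed.

Lemma abs_values_has_sup a (f : holder_even a) : has_sup (abs_values f).
Proof.
have [_ _ H _] := holder_evenP f.
by split=> //; exists `|f 0|, 0.
Qed.

Lemma holder_quotients_has_sup a (f : holder_even a) :
  has_sup (holder_quotients a f).
Proof.
have [_ _ _ H] := holder_evenP f.
by split=> //; eexists; exists 0, 1; split; [rewrite eq_sym oner_neq0|reflexivity].
Qed.

Lemma abs_values_le a (f : holder_even a) x : `|f x| <= sup (abs_values f).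
Proof.
by apply: sup_upper_bound; [exact: abs_values_has_sup|exists x].
Qed.

Lemma holder_quotients_le a (f : holder_even a) x y : x != y ->
  `|f x - f y| <= sup (holder_quotients a f) * `|x - y| `^ a.
Proof.
move: x y; apply/holder_quotientsP.
exact: sup_upper_bound (holder_quotients_has_sup f).
Qed.

Lemma holder_norm_le a (f : holder_even a) A B :
  (forall x, `|f x| <= A) ->
  (forall x y, x != y -> `|f x - f y| <= B * `|x - y| `^ a) ->
  holder_norm f <= A + B.
Proof.
move=> /abs_valuesP fA /holder_quotientsP fB.
apply: lerD; apply: ge_sup => //.
- by have [] := abs_values_has_sup f.
- by have [] := holder_quotients_has_sup f.
Qed.

Lemma sup_abs_values_ge0 a (f : holder_even a) : 0 <= sup (abs_values f).
Proof. exact: le_trans (normr_ge0 _) (abs_values_le f 0). Qed.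

Lemma sup_holder_quotients_ge0 a (f : holder_even a) :
  0 <= sup (holder_quotients a f).
Proof.
have n01 : (0 : R) != 1 by rewrite eq_sym oner_neq0.
have := le_trans (normr_ge0 _) (holder_quotients_le f n01).
by rewrite pmulr_lge0// powR_gt0// normr_gt0 subr_eq0.
Qed.

Lemma holder_normD a (f g : holder_even a) :
  holder_norm (f + g) <= holder_norm f + holder_norm g.
Proof.
rewrite /holder_norm addrACA; apply: holder_norm_le => [x|x y xy].
  change (`|f x + g x| <= sup (abs_values f) + sup (abs_values g)).
  by rewrite (le_trans (ler_normD _ _))// lerD ?abs_values_le.
change (`|f x + g x - (f y + g y)| <=
  (sup (holder_quotients a f) + sup (holder_quotients a g)) * `|x - y| `^ a).
rewrite opprD addrACA (le_trans (ler_normD _ _))// mulrDl.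
by rewrite lerD ?holder_quotients_le.
Qed.

Lemma holder_normZ_le a (k : R) (f : holder_even a) :
  holder_norm (k *: f) <= `|k| * holder_norm f.
Proof.
rewrite /holder_norm mulrDr; apply: holder_norm_le => [x|x y xy].
  change (`|k * f x| <= `|k| * sup (abs_values f)).
  by rewrite normrM ler_wpM2l ?abs_values_le.
change (`|k * f x - k * f y| <=
  `|k| * sup (holder_quotients a f) * `|x - y| `^ a).
by rewrite -mulrBr normrM -mulrA ler_wpM2l ?holder_quotients_le.
Qed.

Lemma holder_normZ a (k : R) (f : holder_even a) :
  holder_norm (k *: f) = `|k| * holder_norm f.
Proof.
apply/eqP; rewrite eq_le holder_normZ_le/=.
have [->|k0] := eqVneq k 0.
  by rewrite normr0 mul0r addr_ge0 ?sup_abs_values_ge0 ?sup_holder_quotients_ge0.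
have := holder_normZ_le k^-1 (k *: f).
by rewrite scalerA mulVf// scale1r normfV ler_pdivlMl ?normr_gt0.
Qed.

Lemma holder_norm_eq0 a (f : holder_even a) : holder_norm f = 0 -> f = 0.
Proof.
move=> /eqP; rewrite paddr_eq0 ?sup_abs_values_ge0 ?sup_holder_quotients_ge0//.
move=> /andP[/eqP f0 _]; apply: val_inj; apply/funext => x.
by have := abs_values_le f x; rewrite f0 normr_le0 => /eqP.
Qed.

HB.instance Definition _ a := Lmodule_isNormed.Build R (holder_even a)
  (@holder_normD a) (@holder_normZ a) (@holder_norm_eq0 a).

Lemma holder_even_normE a (f : holder_even a) : `|f| = holder_norm f.
Proof. by []. Qed.

Lemma holder_even_cauchy_cvg a (F : set_system (holder_even a)) :
  ProperFilter F -> cauchy F -> cvg F.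
Proof.
move=> FF /cauchyP Fc.
have FC e : 0 < e -> exists2 g, F (ball g e) & forall h, ball g e h ->
    (forall x, `|g x - h x| <= e) /\
    (forall x y, x != y -> `|g x - h x - (g y - h y)| <= e * `|x - y| `^ a).
  move=> e0; have [g gF] := Fc e e0; exists g => // h.
  rewrite -ball_normE /= holder_even_normE /holder_norm => gh.
  have A0 := sup_abs_values_ge0 (g - h).
  have B0 := sup_holder_quotients_ge0 (g - h).
  split=> [x|x y xy].
    by apply: le_trans (abs_values_le (g - h) x) _; lra.
  apply: le_trans (holder_quotients_le (g - h) xy) _.
  by rewrite ler_wpM2r ?powR_ge0//; lra.
pose ev x (h : holder_even a) : R := h x.
have evc x : cvg (ev x @ F).
  apply/cauchy_cvgP/cauchyP => e e0; have [g gF gP] := FC _ (divr_gt0 e0 (ltr0n _ 2)).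
  exists (g x); change (F (ev x @^-1` ball (g x : R) e)).
  apply: filterS gF => h /gP[/(_ x) ghx _].
  rewrite -ball_normE /= /ev; apply: le_lt_trans ghx _.
  by rewrite ltr_pdivrMr// ltr_pMr// ltr1n.
pose l x : R^o := lim (ev x @ F).
have limP x : ev x @ F --> (l x : R) by exact: evc.
have cl (c E : R) : closed [set z : R | `|c - z| <= E].
  apply: (closed_comp _ (@closed_le R E)) => z _.
  by apply: cvg_norm; apply: cvgB; [exact: cvg_cst|exact: cvg_id].
have lP e (e0 : 0 < e) : exists2 g, F (ball g e) &
    (forall x, `|g x - l x| <= e) /\
    (forall x y, x != y -> `|g x - l x - (g y - l y)| <= e * `|x - y| `^ a).
  have [g gF gP] := FC e e0; exists g => //; split=> [x|x y xy].
    apply: (@closed_cvg _ _ F _ (ev x) _ (cl (g x) e) _ _ (limP x)).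
    by apply: filterS gF => h /gP[gh _]; exact: gh.
  have lxy : (fun h => ev x h - ev y h) @ F --> (l x - l y : R) by exact: cvgB.
  have -> : g x - l x - (g y - l y) = g x - g y - (l x - l y) by lra.
  set E := e * _.
  apply: (@closed_cvg _ _ F _ _ _ (cl (g x - g y) E) _ _ lxy).
  apply: filterS gF => h /gP[_ /(_ _ _ xy)] /=; rewrite /ev.
  suff -> : g x - h x - (g y - h y) = g x - g y - (h x - h y) by [].
  by lra.
have lin : l \in holder_even_pred a.
  have [g _ [gl1 gl2]] := lP 1 ltr01.
  apply/asboolP; split=> [x|x||].
  - rewrite /l; suff -> : ev (- x) = ev x by [].
    by apply/funext => h; have [H _ _ _] := holder_evenP h; exact: H.
  - rewrite /l; suff -> : ev (x + 2 * pi) = ev x by [].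
    by apply/funext => h; have [_ H _ _] := holder_evenP h; exact: H.
  - exists (sup (abs_values g) + 1); apply/abs_valuesP => x.
    have -> : l x = g x - (g x - l x) by rewrite opprB addrC subrK.
    by rewrite (le_trans (ler_normB _ _))// lerD ?abs_values_le.
  - exists (sup (holder_quotients a g) + 1); apply/holder_quotientsP => x y xy.
    have -> : l x - l y = g x - g y - (g x - l x - (g y - l y)) by lra.
    rewrite (le_trans (ler_normB _ _))// mulrDl lerD ?gl2//.
    exact: holder_quotients_le.
apply/cvg_ex; exists (HolderEven lin); apply/cvgrPdist_le => e e0.
have e40 : 0 < e / 4 by rewrite divr_gt0.
have [g gF [gl1 gl2]] := lP _ e40; apply: filterS gF => h gh.
rewrite -(subrK g (HolderEven lin)) -addrA (le_trans (ler_normD _ _))//.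
have -> : e = (e / 4 + e / 4) + e / 2 by lra.
rewrite lerD//; last first.
  by move: gh; rewrite -ball_normE /= => gh; lra.
rewrite distrC holder_even_normE; apply: holder_norm_le => //.
Qed.

HB.instance Definition _ a :=
  Uniform_isComplete.Build (holder_even a) (@holder_even_cauchy_cvg a).

End holder_even.

Definition analytic_at {R : realType} {V : normedModType R} (f : R -> V)
    (t : R) : Prop :=
  exists (c : nat -> V) (r : R), 0 < r /\
    forall h, `|h| < r -> series (fun n => h ^+ n *: c n) @ \oo --> f (t + h).

Definition kdv_solution {R : realType} (phi : R -> R^o) (mu : R) : Prop :=
  (forall x, phi (x + 2 * pi) = phi x) /\
  forall x : R, [/\ derivable phi x 1, derivable phi^`()%classic x 1 &
    (1 - mu) * phi x + phi x ^+ 2 + 6^-1 * phi^`(2)%classic x = 0].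

(* Main.v *)
From HB Require Import structures.
Require Import Defs.
From mathcomp Require Import all_boot all_order all_algebra.
From mathcomp Require Import all_classical all_reals all_analysis.
From mathcomp Require Import ring lra.
Set Implicit Arguments.
Unset Strict Implicit.
Unset Printing Implicit Defensive.

Import Order.TTheory GRing.Theory Num.Theory.
Import numFieldNormedType.Exports.
Local Open Scope classical_set_scope.
Local Open Scope ring_scope.

(** Write [mu = 5/6 + m]. The equation becomes [phi'' + phi = 6 (m phi - phi ^ 2)],
    whose linear part has kernel spanned by [cos] among even functions. Put
    [phi = e U], [m = e M] and expand [U] and [M] in powers of [e]; the equation
    turns into [U'' + U = 6 e (M U - U ^ 2)] and is solved order by order: the
    coefficient [u_0] is [cos], and [u_(n+1)] and [M_n] are determined by
    [u_0, ..., u_n]. At each order the right-hand side is an even trigonometric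
    polynomial, [M_n] is chosen so that it has no [cos] component
    (Lyapunov-Schmidt, or Lindstedt), and the other modes are divided by
    [1 - k ^ 2] ([branch_coef_equation]).

    Convergence rests on a majorant argument. The sum of the absolute values of
    the coefficients is submultiplicative on cosine polynomials, and division by
    [1 - k ^ 2] for [k <> 1] does not increase it. Hence [a_n], this sum for
    [u_n], is bounded by double and triple convolutions of the earlier ones. The
    weights [1 / (n+1) ^ 2] are stable under convolution up to a factor 8
    ([inv_sqr_conv]), whence [a_n <= r ^ n / (n+1) ^ 2] by induction
    ([wiener_norm_branch_coef]). As [u_n] has degree at most [n+1], each
    derivative costs only a factor [n+1]: derivatives up to order three and
    Hölder norms of [u_n] grow geometrically as well.

    Three facts then turn the formal solution into a true one. A power series
    with geometrically bounded coefficients in a Banach space is analytic in the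
    disk of convergence ([power_series_recenter]) and equals its affine part up
    to a quadratic error ([power_series_affine_approx]); the latter gives the
    derivative at 0, the positivity of [mu] and the nontriviality of [phi].
    Uniform bounds on second derivatives allow termwise differentiation
    ([is_derive_series]). Finally the products [M U] and [U ^ 2] are Cauchy
    products of series ([cvg_cauchy_product]). *)

(** * Series dominated by a geometric series *)

Lemma cvg_norm_le (R : realType) (V : normedModType R) (u : nat -> V) (l : V)
    (B : R) :
  u @ \oo --> l -> (forall n, `|u n| <= B) -> `|l| <= B.
Proof.
move=> ul uB; have nul : (fun n => `|u n|) @ \oo --> `|l| by exact: cvg_norm.
rewrite -(cvg_lim _ nul)//; apply: limr_le; first by apply/cvg_ex; exists `|l|.
exact: nearW.
Qed.

Lemma sum_geometric_le (R : realType) (q : R) (n : nat) :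
  0 <= q < 1 -> \sum_(0 <= i < n) q ^+ i <= (1 - q)^-1.
Proof.
move=> /andP[q0 q1]; rewrite -[leRHS]mul1r ler_pdivlMr ?subr_gt0//.
elim: n => [|n IH]; first by rewrite big_geq// mul0r.
rewrite big_nat_recr//=.
suff: (\sum_(0 <= i < n) q ^+ i + q ^+ n) * (1 - q) = 1 - q ^+ n.+1.
  by move=> ->; rewrite gerBl exprn_ge0.
elim: n {IH} => [|n IH]; first by rewrite big_geq// expr0 expr1 add0r mul1r.
by rewrite big_nat_recr//= mulrDl IH (exprSr q n.+1); ring.
Qed.

Lemma cvg_series_geometric (R : realType) (V : completeNormedModType R)
    (u : nat -> V) (C q : R) :
  0 <= q < 1 -> (forall n, `|u n| <= C * q ^+ n) -> cvgn (series u).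
Proof.
move=> /andP[q0 q1] uC; apply: normed_cvg.
have C0 : 0 <= C by have := le_trans (normr_ge0 _) (uC 0%N); rewrite expr0 mulr1.
apply: (@series_le_cvg _ _ (geometric C q)) => [n|n|n|] //=.
- by rewrite mulr_ge0// exprn_ge0.
- by apply: is_cvg_geometric_series; rewrite ger0_norm.
Qed.

(** Adding [x] to [q] pays for the factor [n], because [n * x * q ^+ n.-1] is a
    summand of the binomial expansion of [(q + x) ^+ n]. *)
Lemma natmul_exp_le (R : realType) (q x : R) (n : nat) :
  0 <= q -> 0 <= x -> q + x <= 1 -> n%:R * x * q ^+ n <= (q + x) ^+ n.
Proof.
move=> q0 x0 qx; elim: n => [|n IH]; first by rewrite !mul0r expr0.
rewrite !exprS -natr1; set a := n%:R in IH *.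
have qn : q ^+ n <= (q + x) ^+ n by rewrite lerXn2r ?nnegrE ?addr_ge0// lerDl.
have qn0 : 0 <= q ^+ n by rewrite exprn_ge0.
have -> : (a + 1) * x * (q * q ^+ n) = q * (a * x * q ^+ n) + x * (q * q ^+ n).
  by ring.
rewrite mulrDl lerD ?ler_wpM2l//; apply: le_trans qn.
by rewrite ler_piMl//; lra.
Qed.

Lemma partial_cauchy_product (R : realType) (a b : nat -> R) (n : nat) :
  \sum_(0 <= k < n) \sum_(0 <= i < k.+1) a i * b (k - i)%N =
  \sum_(0 <= i < n) a i * \sum_(0 <= j < n - i) b j.
Proof.
elim: n => [|n IH]; first by rewrite !big_geq.
rewrite !(big_nat_recr n)//= IH subSnn big_nat1.
rewrite subnn addrA; congr +%R.
rewrite -big_split/=; apply: eq_big_nat => i /andP[_ ilt].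
by rewrite subSn ?(ltnW ilt)// big_nat_recr//= mulrDr.
Qed.

(** The product of the partial sums exceeds the partial sum of the products by
    terms [a i * b j] with [n <= i + j], which add up to at most a multiple of
    [n * q ^+ n]. *)
Lemma cvg_cauchy_product (R : realType) (a b : nat -> R) (A B q la lb : R) :
  0 <= q < 1 ->
  (forall n, `|a n| <= A * q ^+ n) -> (forall n, `|b n| <= B * q ^+ n) ->
  series a @ \oo --> la -> series b @ \oo --> lb ->
  series (fun n => \sum_(0 <= i < n.+1) a i * b (n - i)%N) @ \oo --> la * lb.
Proof.
move=> q01 aA bB ala blb; have /andP[q0 q1] := q01.
have A0 : 0 <= A by have := le_trans (normr_ge0 _) (aA 0%N); rewrite expr0 mulr1.
have B0 : 0 <= B by have := le_trans (normr_ge0 _) (bB 0%N); rewrite expr0 mulr1.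
set c := fun n : nat => _.
pose x := (1 - q) / 2; have x0 : 0 < x by rewrite /x; lra.
have qx1 : q + x < 1 by rewrite /x; lra.
pose K := A * B / (1 - q) / x.
have diff n : `|series a n * series b n - series c n| <= K * (q + x) ^+ n.
  rewrite /series/= partial_cauchy_product mulr_suml -sumrB.
  rewrite (le_trans (ler_norm_sum _ _ _))//.
  apply: (@le_trans _ _ (\sum_(0 <= i < n) A * B / (1 - q) * q ^+ n)).
    apply: ler_sum_nat => i /andP[_ /ltnW ilt]; rewrite -mulrBr normrM.
    have -> : \sum_(0 <= j < n) b j - \sum_(0 <= j < n - i) b j =
              \sum_(0 <= j < i) b (n - i + j)%N.
      rewrite (big_cat_nat (leq0n (n - i)) (leq_subr i n))/= addrAC subrr add0r.
      rewrite -{1}[(n - i)%N]add0n big_addn subKn//.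
      by apply: eq_bigr => j _; rewrite addnC.
    have -> : A * B / (1 - q) * q ^+ n =
              A * q ^+ i * (B * q ^+ (n - i) * (1 - q)^-1).
      by rewrite -{1}(subnKC ilt) exprD; ring.
    apply: ler_pM => //; rewrite (le_trans (ler_norm_sum _ _ _))//.
    apply: (@le_trans _ _ (\sum_(0 <= j < i) B * q ^+ (n - i) * q ^+ j)).
      by apply: ler_sum => j _; rewrite -mulrA -exprD bB.
    rewrite -mulr_sumr ler_wpM2l ?sum_geometric_le//.
    by rewrite mulr_ge0// exprn_ge0.
  rewrite big_const_nat iter_addr_0 subn0 -mulr_natl.
  have -> : n%:R * (A * B / (1 - q) * q ^+ n) = K * (n%:R * x * q ^+ n).
    by rewrite /K; field; rewrite gt_eqF//= gt_eqF// subr_gt0.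
  apply: ler_wpM2l; last by apply: natmul_exp_le => //; exact: ltW.
  by rewrite /K !divr_ge0 ?mulr_ge0 ?subr_ge0// ltW.
have d0 : (fun n => series a n * series b n - series c n) @ \oo --> (0 : R).
  apply: norm_cvg0; apply: (@squeeze_cvgr _ _ _ _ (fun=> 0) (geometric K (q + x))).
  - by apply: nearW => n; rewrite normr_ge0/=; exact: diff.
  - exact: cvg_cst.
  - by apply: cvg_geometric; rewrite ger0_norm// addr_ge0// ltW.
rewrite -[la * lb]subr0.
have -> : series c = (fun n => series a n * series b n -
                        (series a n * series b n - series c n)).
  by apply/funext => n; rewrite subKr.
by apply: cvgB => //; exact: cvgM.
Qed.

(** * Power series in a Banach space *)

Definition power_series (R : realType) (V : completeNormedModType R)
  (c : nat -> V) (t : R) : V := limn (series (fun n => t ^+ n *: c n)).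

Lemma power_series_term_le (R : realType) (V : normedModType R)
    (c : nat -> V) (C g t : R) (n : nat) :
  (forall n, `|c n| <= C * g ^+ n) ->
  `|t ^+ n *: c n| <= C * (`|t| * g) ^+ n.
Proof.
move=> cC; rewrite normrZ normrX exprMn mulrCA ler_wpM2l ?exprn_ge0//.
Qed.

Lemma cvg_power_series (R : realType) (V : completeNormedModType R)
    (c : nat -> V) (C g t : R) :
  (forall n, `|c n| <= C * g ^+ n) -> 0 <= g -> `|t| * g < 1 ->
  series (fun n => t ^+ n *: c n) @ \oo --> power_series c t.
Proof.
move=> cC g0 tg; apply: (@cvg_series_geometric _ _ _ C (`|t| * g)).
  by rewrite mulr_ge0.
by move=> n; exact: power_series_term_le.
Qed.

(** The tail from rank two on is dominated by a geometric series of ratio at most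
    one half, whose sum is at most twice its first term. *)
Lemma power_series_affine_approx (R : realType) (V : completeNormedModType R)
    (c : nat -> V) (C g t : R) :
  (forall n, `|c n| <= C * g ^+ n) -> 0 <= g -> `|t| * g <= 1 / 2 ->
  `|power_series c t - c 0%N - t *: c 1%N| <= 2 * C * (`|t| * g) ^+ 2.
Proof.
move=> cC g0 tg; set q := `|t| * g in tg *.
have q0 : 0 <= q by rewrite mulr_ge0.
have q01 : 0 <= q < 1 by rewrite q0; lra.
have C0 : 0 <= C by have := le_trans (normr_ge0 _) (cC 0%N); rewrite expr0 mulr1.
have := cvg_power_series cC g0 (proj2 (andP q01)).
rewrite -(cvg_shiftn 2) => cv.
apply: (@cvg_norm_le _ _
  (fun n => series (fun n => t ^+ n *: c n) (n + 2)%N - c 0%N - t *: c 1%N)).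
  by apply: cvgB; [apply: cvgB => //; exact: cvg_cst|exact: cvg_cst].
move=> n; rewrite /series/= addn2 2?big_nat_recl//= expr0 expr1 scale1r.
rewrite [X in X - _]addrAC subrr add0r addrAC subrr add0r.
rewrite (le_trans (ler_norm_sum _ _ _))//.
apply: (@le_trans _ _ (\sum_(0 <= i < n) C * q ^+ 2 * q ^+ i)).
  apply: ler_sum => i _; rewrite -mulrA -exprD addnC addn2.
  exact: power_series_term_le.
rewrite -mulr_sumr -[2 * C * _]mulrA [leRHS]mulrC.
rewrite ler_wpM2l ?mulr_ge0 ?exprn_ge0//.
apply: le_trans (sum_geometric_le _ q01) _.
by rewrite -(invrK 2) lef_pV2 ?posrE; lra.
Qed.

(** The part of the binomial expansion of [(t + h) ^+ n] of order at least [K]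
    in [h] gains a factor [2 ^- K] over the whole expansion with [h] replaced by
    an [r] at least twice as large; this is uniform in [n]. *)
Lemma binomial_tail_le (R : realType) (t h r : R) (n K : nat) :
  2 * `|h| <= r ->
  `|(t + h) ^+ n - \sum_(0 <= k < K) h ^+ k * (t ^+ (n - k) *+ 'C(n, k))|
    <= 2 ^- K * (`|t| + r) ^+ n.
Proof.
move=> hr; have r0 : 0 <= r by apply: le_trans hr; rewrite mulr_ge0.
have expand (x y : R) : (x + y) ^+ n =
    \sum_(0 <= k < K + n.+1) y ^+ k * (x ^+ (n - k) *+ 'C(n, k)).
  rewrite exprDn -(big_mkord xpredT (fun k => x ^+ (n - k) * y ^+ k *+ 'C(n, k))).
  rewrite [RHS](big_cat_nat (leq0n n.+1) (leq_addl K n.+1))/=.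
  rewrite [X in _ + X]big_nat_cond [X in _ + X]big1 ?addr0.
    by apply: eq_bigr => k _; rewrite mulrnAr mulrC.
  by move=> k /andP[/andP[nk _] _]; rewrite bin_small// mulr0n mulr0.
rewrite !expand (big_cat_nat (leq0n K) (leq_addr n.+1 K))/= addrAC subrr add0r.
rewrite (le_trans (ler_norm_sum _ _ _))// mulr_sumr.
rewrite [leRHS](big_cat_nat (leq0n K) (leq_addr n.+1 K))/=.
have term0 k : 0 <= r ^+ k * (`|t| ^+ (n - k) *+ 'C(n, k)).
  by rewrite mulr_ge0 ?mulrn_wge0 ?exprn_ge0.
rewrite -[leLHS]add0r lerD//.
  by apply: sumr_ge0 => k _; rewrite mulr_ge0// invr_ge0 exprn_ge0.
apply: ler_sum_nat => k /andP[Kk _].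
rewrite normrM normrMn !normrX mulrA ler_wpM2r ?mulrn_wge0 ?exprn_ge0//.
apply: (@le_trans _ _ ((r / 2) ^+ k)).
  by rewrite lerXn2r ?nnegrE ?divr_ge0//; lra.
rewrite exprMn mulrC ler_wpM2r ?exprn_ge0// exprVn lef_pV2 ?posrE ?exprn_gt0//.
by rewrite ler_weXn2l//; lra.
Qed.

(** Re-expansion at [t]. The coefficients of the new series are read off from
    the binomial theorem; the remainder of order [K] is estimated inside the
    original sum by [binomial_tail_le], which avoids any interchange of
    limits. *)
Lemma power_series_recenter (R : realType) (V : completeNormedModType R)
    (c : nat -> V) (C g t r : R) :
  (forall n, `|c n| <= C * g ^+ n) -> 0 <= g -> 0 < r ->
  (`|t| + 2 * r) * g < 1 ->
  exists d : nat -> V, forall h, `|h| < r ->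
    series (fun k => h ^+ k *: d k) @ \oo --> power_series c (t + h).
Proof.
move=> cC g0 r0 rg; set q := (_ + _) * g in rg.
have r20 : 0 < 2 * r by rewrite mulr_gt0.
have q01 : 0 <= q < 1 by rewrite rg mulr_ge0 ?addr_ge0// ltW.
have C0 : 0 <= C by have := le_trans (normr_ge0 _) (cC 0%N); rewrite expr0 mulr1.
pose s k n := (t ^+ (n - k) *+ 'C(n, k)) *: c n.
pose d k := limn (series (s k)).
have sd k : series (s k) @ \oo --> d k.
  apply: (@cvg_series_geometric _ _ _ ((2 * r) ^- k * C) q) => // n.
  have rk : 0 < (2 * r) ^+ k by rewrite exprn_gt0.
  rewrite -mulrA ler_pdivlMl// /s normrZ normrMn normrX mulrA.
  rewrite /q [in leRHS]exprMn [leRHS]mulrCA ler_pM ?mulr_ge0 ?mulrn_wge0 ?exprn_ge0 ?(ltW r20)//.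
  have [kn|nk] := leqP k n; last first.
    by rewrite bin_small// mulr0n mulr0 exprn_ge0// addr_ge0// ltW.
  rewrite exprDn (bigD1 (Ordinal (kn : (k < n.+1)%N)))//= mulrnAr mulrC lerDl.
  apply: sumr_ge0 => i _.
  by rewrite mulrn_wge0// mulr_ge0// exprn_ge0// ltW.
exists d => h hr.
have htg : `|t + h| * g < 1.
  apply: le_lt_trans rg; rewrite /q ler_wpM2r//.
  by have := ler_normD t h; lra.
have bound K : `|power_series c (t + h) - series (fun k => h ^+ k *: d k) K|
    <= C / (1 - q) * 2^-1 ^+ K.
  apply: (@cvg_norm_le _ _ (fun n => series (fun n => (t + h) ^+ n *: c n) n -
     \sum_(0 <= k < K) h ^+ k *: series (s k) n)).
    apply: cvgB; first exact: cvg_power_series cC g0 htg.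
    rewrite /series/=.
    elim: K => [|K IH].
      by under eq_fun do rewrite big_geq//; rewrite big_geq//; exact: cvg_cst.
    under eq_fun do rewrite big_nat_recr//=.
    by rewrite big_nat_recr//=; apply: cvgD => //; apply: cvgZr; exact: sd.
  move=> n; rewrite /series/=.
  under [X in _ - X]eq_bigr do rewrite scaler_sumr.
  rewrite exchange_big/= -sumrB (le_trans (ler_norm_sum _ _ _))//.
  rewrite mulrAC -mulrA.
  apply: (@le_trans _ _ (\sum_(0 <= i < n) C * 2^-1 ^+ K * q ^+ i)).
    apply: ler_sum => i _.
    under [X in _ - X]eq_bigr do rewrite /s scalerA.
    rewrite -scaler_suml -scalerBl normrZ.
    apply: (@le_trans _ _ (2 ^- K * (`|t| + 2 * r) ^+ i * (C * g ^+ i))).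
      by rewrite ler_pM// binomial_tail_le//; lra.
    suff -> : 2 ^- K * (`|t| + 2 * r) ^+ i * (C * g ^+ i) =
      C * 2^-1 ^+ K * q ^+ i by [].
    by rewrite /q exprMn exprVn; ring.
  rewrite -mulr_sumr mulrA ler_wpM2l ?sum_geometric_le//.
  by rewrite mulr_ge0// exprn_ge0// invr_ge0.
rewrite -[X in _ --> X]subr0.
have -> : series (fun k => h ^+ k *: d k) = (fun K => power_series c (t + h) -
   (power_series c (t + h) - series (fun k => h ^+ k *: d k) K)).
  by apply/funext => K; rewrite subKr.
apply: cvgB; first exact: cvg_cst.
apply: norm_cvg0.
apply: (@squeeze_cvgr _ _ _ _ (fun=> 0) (geometric (C / (1 - q)) 2^-1)).
- by apply: nearW => K; rewrite normr_ge0/=; exact: bound.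
- exact: cvg_cst.
- by apply: cvg_geometric; rewrite ger0_norm ?invr_ge0// invf_lt1// ltr1n.
Qed.

(** * Differentiation *)

Lemma is_derive_quadratic (R : realType) (V : normedModType R) (f : R -> V)
    (v : V) (x B delta : R) :
  0 < delta ->
  (forall h, `|h| < delta -> `|f (x + h) - f x - h *: v| <= B * `|h| ^+ 2) ->
  is_derive x 1 f v.
Proof.
move=> delta0 fB.
suff lim_v : h^-1 *: ((f \o shift x) (h *: 1) - f x) @[h --> 0^'] --> v.
  apply: DeriveDef; first by apply/cvg_ex; exists v.
  exact: cvg_lim lim_v.
apply/cvgrPdist_le => e e0.
have B0 : 0 < `|B| + 1 by rewrite ltr_wpDl.
have eB : 0 < e / (`|B| + 1) by rewrite divr_gt0.
have near_lt d : 0 < d -> \forall h \near 0^', `|h : R| < d.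
  move=> d0; apply: (@nbhs_dnbhs R); exists d => // h /=.
  by rewrite sub0r normrN.
near=> h.
have h0 : h != 0 by near: h; exact: nbhs_dnbhs_neq.
have hd : `|h| < delta by near: h; exact: near_lt.
have he : `|h| < e / (`|B| + 1) by near: h; exact: near_lt.
have nh0 : 0 < `|h| by rewrite normr_gt0.
rewrite distrC /= [h *: 1]mulr1 [h + x]addrC.
have -> : h^-1 *: (f (x + h) - f x) - v =
          h^-1 *: (f (x + h) - f x - h *: v).
  by rewrite [RHS]scalerBr scalerA mulVf// scale1r.
rewrite normrZ normfV ler_pdivrMl//; apply: le_trans (fB _ hd) _.
rewrite expr2 mulrCA ler_wpM2l// ltW//.
move: he; rewrite ltr_pdivlMr// => he.
apply: le_lt_trans he; rewrite mulrC ler_wpM2l// (le_trans (ler_norm _))//.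
by rewrite lerDl.
Unshelve. all: by end_near. Qed.

Lemma MVT_step (R : realType) (f g : R -> R) (x h : R) :
  (forall y : R, is_derive y 1 f (g y)) ->
  exists2 y, `|y - x| <= `|h| & f (x + h) - f x = h * g y.
Proof.
move=> fg.
have cf a b : {within `[a, b], continuous f}.
  by apply: derivable_within_continuous => y _; exact: (@ex_derive _ _ _ _ _ _ _ (fg y)).
have [h0|h0] := leP 0 h.
  have xh : x <= x + h by rewrite lerDl.
  have [y] := MVT_segment xh (fun y _ => fg y) (cf _ _).
  rewrite in_itv/= => /andP[xy yx] E; exists y.
    by rewrite !ger0_norm ?subr_ge0// lerBlDl.
  by rewrite E addrAC subrr add0r mulrC.
have xh : x + h <= x by rewrite gerDl ltW.
have [y] := MVT_segment xh (fun y _ => fg y) (cf _ _).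
rewrite in_itv/= => /andP[xy yx] E; exists y.
  by rewrite (ler0_norm (ltW h0)) ler0_norm ?subr_le0//; lra.
by rewrite -opprB E; ring.
Qed.

Lemma lipschitz_of_derive (R : realType) (f g : R -> R) (K x y : R) :
  (forall z : R, is_derive z 1 f (g z)) -> (forall z, `|g z| <= K) ->
  `|f x - f y| <= K * `|x - y|.
Proof.
move=> fg gK; have [z _ E] := MVT_step y (x - y) fg.
by move: E; rewrite [y + _]addrC subrK => ->; rewrite normrM mulrC ler_wpM2r.
Qed.

(** Summable bounds on the second derivatives make the error of the first order
    Taylor expansion uniformly quadratic along the series. *)
Lemma is_derive_series (R : realType) (f g h : nat -> R -> R) (K : nat -> R)
    (B : R) (F G : R -> R) (x : R) :
  (forall n y, is_derive y (1 : R) (f n) (g n y)) ->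
  (forall n y, is_derive y (1 : R) (g n) (h n y)) ->
  (forall n y, `|h n y| <= K n) ->
  (forall N, \sum_(0 <= n < N) K n <= B) ->
  (forall y, series (f^~ y) @ \oo --> F y) ->
  (forall y, series (g^~ y) @ \oo --> G y) ->
  is_derive x (1 : R) F (G x).
Proof.
move=> fg gh hK KB fF gG.
apply: (@is_derive_quadratic _ _ _ _ _ B 1) => // t _.
apply: (@cvg_norm_le _ _ (fun N => series (f^~ (x + t)) N - series (f^~ x) N -
  t *: series (g^~ x) N)).
  by apply: cvgB; [apply: cvgB; exact: fF|apply: cvgZr; exact: gG].
move=> N; rewrite /series/= scaler_sumr -!sumrB (le_trans (ler_norm_sum _ _ _))//.
apply: (@le_trans _ _ (\sum_(0 <= n < N) K n * `|t| ^+ 2)); last first.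
  by rewrite -mulr_suml ler_wpM2r// exprn_ge0.
apply: ler_sum => n _; have [y yx ->] := MVT_step x t (fg n).
rewrite -[t *: _]/(t * _) -mulrBr normrM expr2 mulrA mulrC ler_wpM2r//.
apply: (le_trans (lipschitz_of_derive _ _ (gh n) (hK n))).
by rewrite ler_wpM2l// (le_trans _ (hK n x)).
Qed.

(** * Cosine polynomials *)

(** Even trigonometric polynomials are stored as ordinary polynomials, the
    coefficient of ['X^k] being the one of [cos (k x)]; [pairing w p] replaces
    ['X^k] by [w k]. *)
Definition pairing (R : realType) (w : nat -> R) (p : {poly R}) : R :=
  \sum_(k < size p) p`_k * w k.

Lemma pairing_widen (R : realType) (w : nat -> R) (p : {poly R}) (n : nat) :
  (size p <= n)%N -> pairing w p = \sum_(k < n) p`_k * w k.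
Proof.
move=> pn; rewrite /pairing (big_ord_widen n (fun k => p`_k * w k))//.
rewrite big_mkcond; apply: eq_bigr => k _; case: ifPn => //.
by rewrite -leqNgt => /(nth_default _) ->; rewrite mul0r.
Qed.

Lemma pairing_is_linear (R : realType) (w : nat -> R) : scalar (pairing w).
Proof.
move=> a p q; pose n := maxn (size (a *: p + q)) (maxn (size p) (size q)).
rewrite !(@pairing_widen _ w _ n) ?leq_max ?leqnn ?orbT//.
rewrite mulr_sumr -big_split/=; apply: eq_bigr => k _.
by rewrite coefD coefZ mulrDl mulrA.
Qed.

HB.instance Definition _ (R : realType) (w : nat -> R) :=
  GRing.isLinear.Build R {poly R} R _ (pairing w) (@pairing_is_linear R w).

Lemma pairingXn (R : realType) (w : nat -> R) (n : nat) :
  pairing w 'X^n = w n.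
Proof.
rewrite /pairing size_polyXn big_ord_recr/= coefXn eqxx mul1r big1 ?add0r// => k _.
by rewrite coefXn ltn_eqF ?mul0r//.
Qed.

(** The norm of the algebra of absolutely convergent cosine series. *)
Definition wiener_norm (R : realType) (p : {poly R}) : R :=
  \sum_(k < size p) `|p`_k|.

Lemma wiener_norm_widen (R : realType) (p : {poly R}) (n : nat) :
  (size p <= n)%N -> wiener_norm p = \sum_(k < n) `|p`_k|.
Proof.
move=> pn; rewrite /wiener_norm (big_ord_widen n (fun k => `|p`_k|))//.
rewrite big_mkcond; apply: eq_bigr => k _; case: ifPn => //.
by rewrite -leqNgt => /(nth_default _) ->; rewrite normr0.
Qed.

Lemma wiener_norm_ge0 (R : realType) (p : {poly R}) : 0 <= wiener_norm p.
Proof. exact: sumr_ge0. Qed.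

Lemma wiener_norm0 (R : realType) : wiener_norm (0 : {poly R}) = 0.
Proof. by rewrite /wiener_norm size_poly0 big_ord0. Qed.

Lemma wiener_normD (R : realType) (p q : {poly R}) :
  wiener_norm (p + q) <= wiener_norm p + wiener_norm q.
Proof.
pose n := maxn (size (p + q)) (maxn (size p) (size q)).
rewrite !(@wiener_norm_widen _ _ n) ?leq_max ?leqnn ?orbT//.
by rewrite -big_split/=; apply: ler_sum => k _; rewrite coefD ler_normD.
Qed.

Lemma wiener_normZ (R : realType) (a : R) (p : {poly R}) :
  wiener_norm (a *: p) = `|a| * wiener_norm p.
Proof.
rewrite [LHS](@wiener_norm_widen _ _ (size p)) ?size_scale_leq// mulr_sumr.
by apply: eq_bigr => k _; rewrite coefZ normrM.
Qed.

Lemma wiener_normN (R : realType) (p : {poly R}) :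
  wiener_norm (- p) = wiener_norm p.
Proof. by rewrite -scaleN1r wiener_normZ normrN1 mul1r. Qed.

Lemma wiener_normXn (R : realType) (n : nat) :
  wiener_norm ('X^n : {poly R}) = 1.
Proof.
rewrite /wiener_norm size_polyXn big_ord_recr/= coefXn eqxx normr1 big1 ?add0r//.
by move=> k _; rewrite coefXn ltn_eqF ?normr0.
Qed.

Lemma wiener_norm_sum (R : realType) (I : Type) (r : seq I) (P : pred I)
    (F : I -> {poly R}) :
  wiener_norm (\sum_(i <- r | P i) F i) <= \sum_(i <- r | P i) wiener_norm (F i).
Proof.
elim/big_rec2: _ => [|i y p _ IH]; first by rewrite wiener_norm0.
by apply: le_trans (wiener_normD _ _) _; rewrite lerD2l.
Qed.

Lemma coef_le_wiener_norm (R : realType) (p : {poly R}) (k : nat) :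
  `|p`_k| <= wiener_norm p.
Proof.
rewrite (@wiener_norm_widen _ p (maxn (size p) k.+1)) ?leq_maxl//.
have kn : (k < maxn (size p) k.+1)%N by rewrite leq_maxr.
by rewrite (bigD1 (Ordinal kn))//= lerDl sumr_ge0.
Qed.

Lemma pairing_le (R : realType) (w : nat -> R) (p : {poly R}) (d : nat) (B : R) :
  (size p <= d.+1)%N -> (forall k, (k <= d)%N -> `|w k| <= B) ->
  `|pairing w p| <= B * wiener_norm p.
Proof.
move=> pd wB; rewrite (pairing_widen w pd) (wiener_norm_widen pd) mulr_sumr.
apply: le_trans (ler_norm_sum _ _ _) _; apply: ler_sum => k _.
by rewrite normrM mulrC ler_wpM2r// wB// -ltnS.
Qed.

(** Multiplication of cosine polynomials, from
    [2 cos (i x) cos (j x) = cos ((i + j) x) + cos (|i - j| x)]; the truncated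
    subtractions add up to [|i - j|]. *)
Definition cos_mul (R : realType) (p q : {poly R}) : {poly R} :=
  \sum_(i < size p) \sum_(j < size q)
    (p`_i * q`_j / 2) *: ('X^(i + j) + 'X^(i - j + (j - i))).

Lemma wiener_norm_cos_mul (R : realType) (p q : {poly R}) :
  wiener_norm (cos_mul p q) <= wiener_norm p * wiener_norm q.
Proof.
rewrite [leRHS]mulr_suml; apply: le_trans (wiener_norm_sum _ _ _) _.
apply: ler_sum => i _; rewrite mulr_sumr.
apply: le_trans (wiener_norm_sum _ _ _) _; apply: ler_sum => j _.
rewrite wiener_normZ !normrM normfV normr_nat -[leRHS]mulr1.
rewrite -[leLHS]mulrA ler_wpM2l ?mulr_ge0// ler_pdivrMl// mulr1.
by apply: le_trans (wiener_normD _ _) _; rewrite !wiener_normXn.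
Qed.

Lemma size_cos_mul (R : realType) (p q : {poly R}) (m n : nat) :
  (size p <= m.+1)%N -> (size q <= n.+1)%N ->
  (size (cos_mul p q) <= (m + n).+1)%N.
Proof.
move=> pm qn; apply: leq_trans (size_sum _ _ _) _; apply/bigmax_leqP => i _.
apply: leq_trans (size_sum _ _ _) _; apply/bigmax_leqP => j _.
have im : (i <= m)%N by rewrite -ltnS (leq_trans _ pm).
have jn : (j <= n)%N by rewrite -ltnS (leq_trans _ qn).
apply: leq_trans (size_scale_leq _ _) _; apply: leq_trans (size_polyD _ _) _.
by rewrite !size_polyXn geq_max !ltnS leq_add//= leq_add// (leq_trans (leq_subr _ _)).
Qed.

(** The weights of the [j]-th derivative: each derivative of a cosine shifts
    the phase by a quarter period. *)
Definition cos_weight (R : realType) (j : nat) (x : R) (k : nat) : R :=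
  k%:R ^+ j * cos (k%:R * x + (pi / 2) *+ j).

Definition cos_poly (R : realType) (j : nat) (p : {poly R}) (x : R) : R :=
  pairing (cos_weight j x) p.

Lemma cos_weight0 (R : realType) (x : R) (k : nat) :
  cos_weight 0 x k = cos (k%:R * x).
Proof. by rewrite /cos_weight expr0 mulr0n addr0 mul1r. Qed.

Lemma cos_weight2 (R : realType) (x : R) (k : nat) :
  cos_weight 2 x k = - k%:R ^+ 2 * cos_weight 0 x k.
Proof.
rewrite cos_weight0 /cos_weight; have -> : pi / 2 *+ 2 = pi :> R.
  by rewrite -mulr_natr divfK.
by rewrite cosDpi mulrN mulNr.
Qed.

Lemma cos_weight_le (R : realType) (j k d : nat) (x : R) :
  (k <= d)%N -> `|cos_weight j x k| <= d%:R ^+ j.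
Proof.
move=> kd; rewrite normrM normrX normr_nat -[leRHS]mulr1.
rewrite ler_pM ?exprn_ge0//; first by rewrite lerXn2r ?nnegrE// ler_nat.
by rewrite ler_norml cos_geN1 cos_le1.
Qed.

Lemma is_derive_cos_weight (R : realType) (j k : nat) (x : R) :
  is_derive x (1 : R) (fun y => cos_weight j y k) (cos_weight j.+1 x k).
Proof.
rewrite /cos_weight; set b : R := _ *+ j.
have -> : k%:R * x + pi / 2 *+ j.+1 = k%:R * x + b + pi / 2.
  by rewrite mulrSr addrA.
rewrite cosDpihalf.
apply: is_derive_eq; rewrite /GRing.scale/= !(mulr0, mul0r, addr0, add0r, mulr1).
by rewrite exprSr; ring.
Qed.

Lemma is_derive_cos_poly (R : realType) (j : nat) (p : {poly R}) (x : R) :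
  is_derive x (1 : R) (cos_poly j p) (cos_poly j.+1 p x).
Proof.
rewrite /cos_poly /pairing.
have -> : (fun y => \sum_(k < size p) p`_k * cos_weight j y k) =
          \sum_(k < size p) (fun y => p`_k * cos_weight j y k).
  by apply/funext => y; rewrite fct_sumE.
apply: is_derive_sum => k.
have := is_derive_cos_weight j k x => dk.
exact: is_derive_eq.
Qed.

Lemma cos_poly_le (R : realType) (j d : nat) (p : {poly R}) (x : R) :
  (size p <= d.+1)%N -> `|cos_poly j p x| <= d%:R ^+ j * wiener_norm p.
Proof.
move=> pd; apply: (pairing_le pd) => k kd; exact: cos_weight_le.
Qed.

Lemma cos_poly_even (R : realType) (p : {poly R}) (x : R) :
  cos_poly 0 p (- x) = cos_poly 0 p x.
Proof.
apply: eq_bigr => k _; rewrite !cos_weight0.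
by rewrite mulrN cosN.
Qed.

Lemma cos_poly_periodic (R : realType) (p : {poly R}) (x : R) :
  cos_poly 0 p (x + 2 * pi) = cos_poly 0 p x.
Proof.
apply: eq_bigr => k _; rewrite !cos_weight0 mulrDr.
have -> : k%:R * (2 * pi) = (pi *+ 2) *+ k :> R.
  by rewrite mulr_natl mulr_natl.
by rewrite periodicn//; exact: cosD2pi.
Qed.

Lemma cos_polyX (R : realType) (x : R) : cos_poly 0 'X x = cos x.
Proof. by rewrite /cos_poly -['X]expr1 pairingXn cos_weight0 mul1r. Qed.

Lemma cos_polyM (R : realType) (p q : {poly R}) (x : R) :
  cos_poly 0 (cos_mul p q) x = cos_poly 0 p x * cos_poly 0 q x.
Proof.
rewrite /cos_poly /cos_mul raddf_sum [in RHS]/pairing mulr_suml.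
apply: eq_bigr => i _; rewrite raddf_sum mulr_sumr; apply: eq_bigr => j _ /=.
rewrite linearZ/= linearD/= !pairingXn !cos_weight0.
have -> : cos ((i - j + (j - i))%:R * x) = cos (i%:R * x - j%:R * x).
  rewrite -mulrBl; have [ji|/ltnW ij] := leqP j i.
    by rewrite (eqP (_ : (j - i)%N == 0%N)) ?subn_eq0// addn0 natrB.
  rewrite (eqP (_ : (i - j)%N == 0%N)) ?subn_eq0// add0n natrB//.
  by rewrite -cosN -mulNr opprB.
by rewrite natrD mulrDl cosD cosD sinN cosN /GRing.scale/=; field.
Qed.

(** The inverse of [f |-> f'' + f] off its kernel, spanned by [cos]. *)
Definition resolvent (R : realType) (p : {poly R}) : {poly R} :=
  \poly_(k < size p) (if k == 1%N then 0 else p`_k / (1 - k%:R ^+ 2)).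

Lemma size_resolvent (R : realType) (p : {poly R}) :
  (size (resolvent p) <= size p)%N.
Proof. exact: size_poly. Qed.

Lemma coef1_resolvent (R : realType) (p : {poly R}) : (resolvent p)`_1 = 0.
Proof. by rewrite coef_poly; case: ifP. Qed.

Lemma natr_sqr_subr1 (R : realType) (k : nat) :
  k != 1%N -> 1 <= `|1 - k%:R ^+ 2 : R|.
Proof.
case: k => [|[//|k]] _; first by rewrite expr0n subr0 normr1.
rewrite distrC; apply: le_trans (ler_norm _).
have : 0 <= k%:R :> R by [].
by rewrite -addn2 natrD; nra.
Qed.

Lemma wiener_norm_resolvent (R : realType) (p : {poly R}) :
  wiener_norm (resolvent p) <= wiener_norm p.
Proof.
rewrite (wiener_norm_widen (size_resolvent p)); apply: ler_sum => k _.
rewrite coef_poly ltn_ord; case: ifPn => [_|k1]; first by rewrite normr0.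
have n1 := natr_sqr_subr1 R k1.
by rewrite normrM normfV ler_pdivrMr ?ler_peMr// (lt_le_trans _ n1).
Qed.

Lemma resolventK (R : realType) (p : {poly R}) (x : R) :
  cos_poly 2 (resolvent p) x + cos_poly 0 (resolvent p) x =
  cos_poly 0 p x - p`_1 * cos x.
Proof.
rewrite -cos_polyX /cos_poly.
have -> : p`_1 * pairing (cos_weight 0 x) 'X = pairing (cos_weight 0 x) (p`_1 *: 'X).
  by rewrite linearZ.
rewrite -linearB/=.
rewrite (@pairing_widen _ _ (p - _) (size p + 2)); last first.
  rewrite (leq_trans (size_polyD _ _))// geq_max leq_addr/= size_polyN.
  by rewrite (leq_trans (size_scale_leq _ _))// size_polyX leq_addl.
rewrite !(@pairing_widen _ _ (resolvent p) (size p + 2)) -?big_split/=; first last.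
- by rewrite (leq_trans (size_resolvent p))// leq_addr.
- by rewrite (leq_trans (size_resolvent p))// leq_addr.
apply: eq_bigr => k _; rewrite cos_weight2 coef_poly coefB coefZ coefX.
have [k1|k1] := eqVneq (k : nat) 1%N.
  by rewrite k1 mulr1 subrr !mul0r if_same !mul0r addr0.
rewrite mulr0 subr0.
have n0 : 1 - k%:R ^+ 2 != 0 :> R.
  by rewrite -normr_gt0 (lt_le_trans _ (natr_sqr_subr1 R k1)).
case: ltnP => [_|/(nth_default _) ->]; last by rewrite !mul0r addr0.
by field.
Qed.

(** * The coefficients of the bifurcating branch *)

Definition cos_conv (R : realType) (u : nat -> {poly R}) (n : nat) : {poly R} :=
  \sum_(0 <= i < n.+1) cos_mul (u i) (u (n - i)%N).

(** The summand [i = n], a multiple of [cos], is left out because the resolvent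
    annihilates it. *)
Definition branch_step (R : realType) (u : nat -> {poly R}) (n : nat) :
    {poly R} :=
  6 *: resolvent (\sum_(0 <= i < n) (cos_conv u i)`_1 *: u (n - i)%N -
                  cos_conv u n).

(** Course-of-values recursion: [branch_history n] agrees with the sequence of
    coefficients up to rank [n], which is all that the next step consults. *)
Fixpoint branch_history (R : realType) (n : nat) : nat -> {poly R} :=
  if n is m.+1 then
    fun k => if (k <= m)%N then branch_history R m k
             else branch_step (branch_history R m) m
  else fun=> 'X.

Definition branch_coef (R : realType) (n : nat) : {poly R} :=
  branch_history R n n.

Definition speed_coef (R : realType) (n : nat) : R :=
  (cos_conv (branch_coef R) n)`_1.

Lemma eq_cos_conv (R : realType) (u v : nat -> {poly R}) (n : nat) :
  (forall k, (k <= n)%N -> u k = v k) -> cos_conv u n = cos_conv v n.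
Proof.
move=> uv; apply: eq_big_nat => i /andP[_]; rewrite ltnS => i_n.
by rewrite !uv// leq_subr.
Qed.

Lemma eq_branch_step (R : realType) (u v : nat -> {poly R}) (n : nat) :
  (forall k, (k <= n)%N -> u k = v k) -> branch_step u n = branch_step v n.
Proof.
move=> uv; rewrite /branch_step (eq_cos_conv uv); congr (_ *: resolvent (_ - _)).
apply: eq_big_nat => i /andP[_ i_n]; rewrite uv ?leq_subr//.
by rewrite (@eq_cos_conv _ u v)// => k ki; rewrite uv// (leq_trans ki)// ltnW.
Qed.

Lemma branch_history_coef (R : realType) (n k : nat) :
  (k <= n)%N -> branch_history R n k = branch_coef R k.
Proof.
elim: n => [|n IH]; first by rewrite leqn0 => /eqP ->.
rewrite leq_eqVlt => /orP[/eqP -> //|]; rewrite ltnS => kn /=.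
by rewrite kn IH.
Qed.

Lemma branch_coefS (R : realType) (n : nat) :
  branch_coef R n.+1 = branch_step (branch_coef R) n.
Proof.
rewrite /branch_coef/= ltnn; apply: eq_branch_step => k kn.
exact: branch_history_coef.
Qed.

Lemma size_branch_coef (R : realType) (n : nat) :
  (size (branch_coef R n) <= n.+2)%N.
Proof.
elim/ltn_ind: n => [[|n] IH]; first by rewrite size_polyX.
rewrite branch_coefS; apply: leq_trans (size_scale_leq _ _) _.
apply: leq_trans (size_resolvent _) _; apply: leq_trans (size_polyD _ _) _.
rewrite geq_max size_polyN; apply/andP; split.
  apply: leq_trans (size_sum _ _ _) _; apply/bigmax_leqP_seq => i.
  rewrite mem_index_iota => /andP[_ i_n] _; apply: leq_trans (size_scale_leq _ _) _.
  apply: leq_trans (IH _ _) _; first by rewrite ltnS leq_subr.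
  by rewrite !ltnS (leq_trans (leq_subr _ _)).
apply: leq_trans (size_sum _ _ _) _; apply/bigmax_leqP_seq => i.
rewrite mem_index_iota => /andP[_ i_n] _.
apply: leq_trans (size_cos_mul (IH i _) (IH (n - i)%N _)) _ => //.
  by rewrite ltnS leq_subr.
by rewrite addnS addSn subnKC.
Qed.

Lemma coef1_branch_coefS (R : realType) (n : nat) :
  (branch_coef R n.+1)`_1 = 0.
Proof. by rewrite branch_coefS coefZ coef1_resolvent mulr0. Qed.

(** The order [n.+1] of [U'' + U = 6 e (M U - U ^ 2)]. The resolvent leaves the
    resonant part [p`_1 * cos] of its argument [p] unsolved, and the summand
    [i = n] of the first sum, equal to [speed_coef R n * cos], cancels it; the
    normalization [(u_k)`_1 = 0] for [k > 0] is what makes [p`_1] equal to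
    [- speed_coef R n]. *)
Lemma branch_coef_equation (R : realType) (n : nat) (x : R) :
  cos_poly 2 (branch_coef R n.+1) x + cos_poly 0 (branch_coef R n.+1) x =
  6 * (\sum_(0 <= i < n.+1) speed_coef R i * cos_poly 0 (branch_coef R (n - i)) x -
       \sum_(0 <= i < n.+1)
         cos_poly 0 (branch_coef R i) x * cos_poly 0 (branch_coef R (n - i)) x).
Proof.
rewrite branch_coefS /branch_step; set p : {poly R} := _ - _.
have scale6 j : cos_poly j (6 *: resolvent p) x = 6 * cos_poly j (resolvent p) x.
  by rewrite /cos_poly linearZ.
rewrite !scale6.
rewrite -mulrDr resolventK; congr (6 * _).
have p1 : p`_1 = - speed_coef R n.
  rewrite coefB coef_sum big_nat big1 ?sub0r// => i /andP[_ i_n].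
  by rewrite coefZ -subnSK// coef1_branch_coefS mulr0.
rewrite p1 mulNr opprK big_nat_recr//= subnn.
rewrite [cos_poly 0 (branch_coef R 0) x]cos_polyX addrAC; congr (_ + _).
rewrite /cos_poly /p linearB/=; congr (_ - _); rewrite linear_sum/=.
  by apply: eq_bigr => i _; rewrite linearZ.
by apply: eq_bigr => i _; exact: cos_polyM.
Qed.

Lemma branch_coef0_equation (R : realType) (x : R) :
  cos_poly 2 (branch_coef R 0) x + cos_poly 0 (branch_coef R 0) x = 0.
Proof.
rewrite /branch_coef/= /cos_poly -['X]expr1 !pairingXn cos_weight2.
by rewrite expr1n mulN1r addNr.
Qed.

(** * Geometric growth of the coefficients *)

Definition inv_sqr (R : realType) (n : nat) : R := (n.+1%:R ^+ 2)^-1.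

Lemma inv_sqr_ge0 (R : realType) (n : nat) : 0 <= inv_sqr R n.
Proof. by rewrite invr_ge0 exprn_ge0. Qed.

Lemma sum_inv_sqr_le (R : realType) (n : nat) :
  \sum_(0 <= i < n) inv_sqr R i <= 2.
Proof.
case: n => [|n]; first by rewrite big_geq.
suff H : \sum_(0 <= i < n.+1) inv_sqr R i <= 2 - n.+1%:R^-1.
  by apply: le_trans H _; rewrite gerBl invr_ge0.
elim: n => [|n IH]; first by rewrite big_nat1 /inv_sqr expr1n invr1; lra.
rewrite big_nat_recr//=; apply: le_trans (lerD IH (lexx _)) _.
rewrite /inv_sqr -[n.+2]addn1 natrD; set a : R := n.+1%:R.
have a0 : 0 < a by [].
rewrite -subr_ge0.
have -> : 2 - (a + 1)^-1 - (2 - a^-1 + ((a + 1) ^+ 2)^-1) =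
          (a * (a + 1) ^+ 2)^-1.
  by field; rewrite !gt_eqF// ltr_wpDr.
by rewrite invr_ge0 mulr_ge0 ?exprn_ge0 ?addr_ge0// ltW.
Qed.

(** The weights [inv_sqr] are, up to a constant, stable under convolution:
    [1 / (a b) = (1 / a + 1 / b) / (a + b)]. *)
Lemma inv_sqr_conv (R : realType) (n : nat) :
  \sum_(0 <= i < n.+1) inv_sqr R i * inv_sqr R (n - i) <= 8 * inv_sqr R n.+1.
Proof.
apply: (@le_trans _ _ (\sum_(0 <= i < n.+1)
    2 * inv_sqr R n.+1 * (inv_sqr R i + inv_sqr R (n - i)))).
  apply: ler_sum_nat => i /andP[_]; rewrite ltnS => i_n.
  rewrite /inv_sqr; have -> : n.+2%:R = i.+1%:R + (n - i).+1%:R :> R.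
    by rewrite -natrD addnS addSn subnKC.
  set a : R := i.+1%:R; set b : R := (n - i).+1%:R.
  have a0 : 0 < a by []. have b0 : 0 < b by [].
  have ab0 : 0 < a + b by rewrite addr_gt0.
  rewrite -subr_ge0.
  have -> : 2 * ((a + b) ^+ 2)^-1 * ((a ^+ 2)^-1 + (b ^+ 2)^-1) -
            (a ^+ 2)^-1 * (b ^+ 2)^-1 = (a - b) ^+ 2 / (a * b * (a + b)) ^+ 2.
    by field; rewrite !gt_eqF.
  by rewrite mulr_ge0 ?invr_ge0 ?sqr_ge0.
rewrite -mulr_sumr big_split/=.
have -> : \sum_(0 <= i < n.+1) inv_sqr R (n - i) = \sum_(0 <= i < n.+1) inv_sqr R i.
  by rewrite [RHS]big_nat_rev/= add0n; apply: eq_bigr => i _; rewrite subSS.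
have := sum_inv_sqr_le R n.+1; have := inv_sqr_ge0 R n.+1; nra.
Qed.

Lemma geometric_conv_le (R : realType) (a b : nat -> R) (A B r : R) (n : nat) :
  0 <= r -> 0 <= A -> 0 <= B ->
  (forall i, (i <= n)%N -> 0 <= a i <= A * r ^+ i * inv_sqr R i) ->
  (forall i, (i <= n)%N -> 0 <= b i <= B * r ^+ i * inv_sqr R i) ->
  \sum_(0 <= i < n.+1) a i * b (n - i)%N <=
  8 * A * B * r ^+ n * inv_sqr R n.+1.
Proof.
move=> r0 A0 B0 aA bB.
apply: (@le_trans _ _ (\sum_(0 <= i < n.+1)
    A * B * r ^+ n * (inv_sqr R i * inv_sqr R (n - i)))).
  apply: ler_sum_nat => i /andP[_]; rewrite ltnS => i_n.
  have /andP[a0 ai] := aA _ i_n; have /andP[b0 bi] := bB _ (leq_subr i n).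
  apply: le_trans (ler_pM a0 b0 ai bi) _.
  by rewrite -{3}(subnKC i_n) exprD le_eqVlt; apply/orP; left; apply/eqP; ring.
rewrite -mulr_sumr.
have -> : 8 * A * B * r ^+ n * inv_sqr R n.+1 =
          A * B * r ^+ n * (8 * inv_sqr R n.+1) by ring.
by rewrite ler_wpM2l ?inv_sqr_conv// !mulr_ge0// exprn_ge0.
Qed.

Lemma wiener_norm_cos_conv (R : realType) (u : nat -> {poly R}) (n : nat) :
  wiener_norm (cos_conv u n) <=
  \sum_(0 <= i < n.+1) wiener_norm (u i) * wiener_norm (u (n - i)%N).
Proof.
apply: le_trans (wiener_norm_sum _ _ _) _; apply: ler_sum => i _.
exact: wiener_norm_cos_mul.
Qed.

(** The bound [432 = 6 * (8 * 8 + 8)] collects the factor of the recursion and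
    one constant of [inv_sqr_conv] for each convolution. *)
Lemma wiener_norm_branch_coef (R : realType) (r : R) (n : nat) :
  432 <= r -> wiener_norm (branch_coef R n) <= r ^+ n * inv_sqr R n.
Proof.
move=> r432; have r0 : 0 <= r by lra.
elim/ltn_ind: n => [[|n] IH].
  by rewrite /branch_coef/= -['X]expr1 wiener_normXn expr0 /inv_sqr expr1n invr1 mul1r.
have norm_le k : (k <= n)%N ->
    0 <= wiener_norm (branch_coef R k) <= 1 * r ^+ k * inv_sqr R k.
  by move=> kn; rewrite wiener_norm_ge0 mul1r IH.
have conv_le k : (k <= n)%N ->
    wiener_norm (cos_conv (branch_coef R) k) <= 8 * r ^+ k * inv_sqr R k.+1.
  move=> kn; apply: le_trans (wiener_norm_cos_conv _ _) _.
  have norm_le_k i : (i <= k)%N -> _ := fun ik => norm_le i (leq_trans ik kn).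
  have := geometric_conv_le r0 ler01 ler01 norm_le_k norm_le_k.
  by rewrite !mulr1.
pose a i : R := `|(cos_conv (branch_coef R) i)`_1|.
pose b i := wiener_norm (branch_coef R i).
have a_le i : (i <= n)%N -> 0 <= a i <= 8 * r ^+ i * inv_sqr R i.
  move=> i_n; rewrite normr_ge0/=; apply: le_trans (coef_le_wiener_norm _ _) _.
  apply: le_trans (conv_le _ i_n) _; rewrite ler_wpM2l ?mulr_ge0 ?exprn_ge0//.
  by rewrite lef_pV2 ?posrE ?exprn_gt0// lerXn2r ?nnegrE// ler_nat.
have ab := geometric_conv_le r0 (ler0n R 8) ler01 a_le norm_le.
rewrite branch_coefS /branch_step wiener_normZ ger0_norm//.
set p := (X in resolvent (X - _)).
have p_le : wiener_norm p <= 8 * 8 * r ^+ n * inv_sqr R n.+1.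
  rewrite mulr1 in ab; apply: le_trans ab.
  apply: le_trans (wiener_norm_sum _ _ _) _.
  rewrite [leRHS]big_nat_recr//= -[leLHS]addr0 lerD//.
    by apply: ler_sum => i _; rewrite wiener_normZ.
  by rewrite mulr_ge0 ?normr_ge0 ?wiener_norm_ge0.
have res_le := le_trans (wiener_norm_resolvent _)
  (wiener_normD p (- cos_conv (branch_coef R) n)).
rewrite wiener_normN in res_le; have q_le := conv_le n (leqnn n).
have w0 : 0 <= r ^+ n * inv_sqr R n.+1 by rewrite mulr_ge0 ?inv_sqr_ge0 ?exprn_ge0.
rewrite exprS -[leRHS]mulrA.
move: w0 p_le q_le; rewrite -![_ * r ^+ n * _]mulrA; set w := r ^+ n * _.
move=> w0 p_le q_le; apply: (@le_trans _ _ (432 * w)); last exact: ler_wpM2r.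
by lra.
Qed.

Lemma natS_le_exp2 (R : realType) (n : nat) : n.+1%:R <= 2 ^+ n :> R.
Proof. by rewrite -natrX ler_nat ltn_expl. Qed.

(** Three derivatives of [branch_coef R n], whose degree is at most [n.+1], cost
    a factor [n.+1%:R ^+ 3]; [inv_sqr] absorbs two powers of it and the doubling
    of the ratio the third. *)
Lemma cos_poly_branch_coef_le (R : realType) (r : R) (j n : nat) (x : R) :
  432 <= r -> (j <= 3)%N ->
  `|cos_poly j (branch_coef R n) x| <= (2 * r) ^+ n.
Proof.
move=> r432 j3; have r0 : 0 <= r by lra.
apply: le_trans (cos_poly_le _ _ (size_branch_coef R n)) _.
apply: (@le_trans _ _ (n.+1%:R ^+ 3 * (r ^+ n * inv_sqr R n))).
  apply: ler_pM (wiener_norm_branch_coef _ r432) => //.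
  - exact: wiener_norm_ge0.
  - by rewrite ler_weXn2l// ler1n.
have -> : n.+1%:R ^+ 3 * (r ^+ n * inv_sqr R n) = n.+1%:R * r ^+ n.
  by rewrite /inv_sqr; field.
by rewrite exprMn ler_wpM2r ?exprn_ge0// natS_le_exp2.
Qed.

Lemma speed_coef_le (R : realType) (r : R) (n : nat) :
  432 <= r -> `|speed_coef R n| <= 2 * (2 * r) ^+ n.
Proof.
move=> r432; have r0 : 0 <= r by lra.
have norm_le i : (i <= n)%N ->
    0 <= wiener_norm (branch_coef R i) <= 1 * r ^+ i * inv_sqr R i.
  by move=> _; rewrite wiener_norm_ge0 mul1r wiener_norm_branch_coef.
have := geometric_conv_le r0 ler01 ler01 norm_le norm_le.
have := le_trans (coef_le_wiener_norm _ 1) (wiener_norm_cos_conv (branch_coef R) n).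
rewrite -/(speed_coef R n) => H1 H2; apply: le_trans H1 (le_trans H2 _).
have i4 : inv_sqr R n.+1 <= 4^-1.
  rewrite lef_pV2 ?posrE ?exprn_gt0//.
  have -> : 4 = 2 ^+ 2 :> R by rewrite -natrX.
  by rewrite lerXn2r ?nnegrE// ler_nat.
have rn : r ^+ n <= (2 * r) ^+ n by rewrite lerXn2r ?nnegrE ?mulr_ge0//; lra.
have rn0 : 0 <= r ^+ n by rewrite exprn_ge0.
by rewrite !mulr1; nra.
Qed.

(** * Passing to the Hölder space *)

(** A bound on the derivative controls the increments at distance at most one, a
    bound on the function those at larger distance. *)
Lemma holder_even_of_derive (R : realType) (a A B : R) (f g : R -> R) :
  0 <= a -> a <= 1 ->
  (forall x, f (- x) = f x) -> (forall x, f (x + 2 * pi) = f x) ->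
  (forall x : R, is_derive x (1 : R) f (g x)) ->
  (forall x, `|f x| <= A) -> (forall x, `|g x| <= B) ->
  exists F : holder_even a, (forall x, F x = f x) /\ `|F| <= 3 * A + B.
Proof.
move=> a0 a1 fe fp fg fA gB.
have A0 : 0 <= A := le_trans (normr_ge0 _) (fA 0).
have B0 : 0 <= B := le_trans (normr_ge0 _) (gB 0).
have quot x y : x != y -> `|f x - f y| <= (2 * A + B) * `|x - y| `^ a.
  rewrite -subr_eq0 -normr_gt0 => xy.
  have p0 : 0 <= `|x - y| `^ a by exact: powR_ge0.
  have [d1|d1] := leP `|x - y| 1.
    apply: le_trans (lipschitz_of_derive _ _ fg gB) _.
    have dp : `|x - y| <= `|x - y| `^ a by apply: ger1_powR => //; rewrite xy.
    by nra.
  have p1 : 1 <= `|x - y| `^ a.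
    rewrite -(powRr0 `|x - y|); apply: ler_powR => //; exact: ltW.
  have fxy : `|f x - f y| <= 2 * A.
    by apply: le_trans (ler_normB _ _) _; have := fA x; have := fA y; lra.
  by nra.
have Fin : (f : R -> R^o) \in holder_even_pred a.
  apply/asboolP; split=> //.
    by exists A; apply/abs_valuesP.
  by exists (2 * A + B); apply/holder_quotientsP.
exists (HolderEven Fin); split=> //.
have -> : 3 * A + B = A + (2 * A + B) by ring.
by rewrite holder_even_normE; apply: holder_norm_le.
Qed.

Lemma holder_even_norm_ge (R : realType) (a x : R) (f : holder_even a) :
  `|f x| <= `|f|.
Proof.
rewrite holder_even_normE; apply: le_trans (abs_values_le f x) _.
by rewrite lerDl sup_holder_quotients_ge0.
Qed.

(** Evaluation at a point is continuous on the Hölder space. *)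
Lemma cvg_series_eval (R : realType) (a x : R) (u : nat -> holder_even a)
    (f : holder_even a) :
  series u @ \oo --> f -> series (fun n => u n x : R) @ \oo --> (f x : R).
Proof.
move=> uf.
have E n : series (fun n => u n x : R) n = series u n x.
  rewrite /series/=; elim: n => [|n IH]; first by rewrite !big_geq.
  by rewrite !big_nat_recr//= IH.
apply/cvgrPdist_le => e e0.
have /cvgrPdist_le/(_ e e0) := uf; apply: filterS => n; apply: le_trans.
by rewrite E; exact: (holder_even_norm_ge x (f - series u n)).
Qed.

Lemma power_series_shift (R : realType) (V : completeNormedModType R)
    (c : nat -> V) (C g t : R) :
  (forall n, `|c n.+1| <= C * g ^+ n) -> 0 <= g -> `|t| * g < 1 ->
  power_series c t = c 0%N + t *: power_series (fun n => c n.+1) t.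
Proof.
move=> cC g0 tg; apply: cvg_lim => //.
rewrite -(cvg_shiftn 1).
have -> : [sequence series (fun n => t ^+ n *: c n) (n + 1)%N]_n =
    (fun n => c 0%N + t *: series (fun n => t ^+ n *: c n.+1) n).
  apply/funext => n; rewrite /series/= addn1 big_nat_recl//= expr0 scale1r.
  by rewrite scaler_sumr; under [in RHS]eq_bigr do rewrite scalerA -exprS.
apply: cvgD; first exact: cvg_cst.
by apply: cvgZr; exact: (cvg_power_series cC).
Qed.

Lemma analytic_at_power_series_pair (R : realType) (V : completeNormedModType R)
    (c : nat -> V) (d : nat -> R) (C g e : R) :
  (forall n, `|c n| <= C * g ^+ n) -> (forall n, `|d n| <= C * g ^+ n) ->
  0 < g -> `|e| * g < 1 ->
  analytic_at
    (fun s : R => (power_series c s, power_series d s) : (V * R^o)%type) e.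
Proof.
move=> cC dC g0 eg; pose r := (g^-1 - `|e|) / 4.
have r0 : 0 < r by rewrite divr_gt0// subr_gt0 -[g^-1]mul1r ltr_pdivlMr.
have rg : (`|e| + 2 * r) * g < 1.
  have -> : (`|e| + 2 * r) * g = (1 + `|e| * g) / 2.
    by rewrite /r; field; rewrite gt_eqF.
  by lra.
have [c' c'P] := power_series_recenter cC (ltW g0) r0 rg.
have [d' d'P] := power_series_recenter dC (ltW g0) r0 rg.
exists (fun n => (c' n, d' n)), r; split=> // h hr.
have -> : series (fun n => h ^+ n *: ((c' n, d' n) : (V * R^o)%type)) =
    (fun n => (series (fun n => h ^+ n *: c' n) n,
               series (fun n => h ^+ n *: d' n) n)).
  apply/funext => n; rewrite /series/=.
  elim: n => [|n IH]; first by rewrite !big_geq.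
  by rewrite !big_nat_recr//= IH.
exact: (cvg_pair (c'P _ hr) (d'P _ hr)).
Qed.

(** * The branch solves the equation *)

Section branch.
Context (R : realType) (r e : R).
Context (r_ge : 432 <= r) (e_lt : `|e| * (2 * r) < 1).

Let q01 : 0 <= `|e| * (2 * r) < 1.
Proof. by rewrite e_lt andbT !mulr_ge0// (le_trans (ler0n R 432)).  Qed.

Definition branch_profile (j : nat) (x : R) : R :=
  power_series (fun n => cos_poly j (branch_coef R n) x) e.

Definition branch_speed : R := power_series (speed_coef R) e.

Let profile_term_le j n x : (j <= 3)%N ->
  `|e ^+ n * cos_poly j (branch_coef R n) x| <= 1 * (`|e| * (2 * r)) ^+ n.
Proof.
move=> j3; apply: (@power_series_term_le R R^o
  (fun n => cos_poly j (branch_coef R n) x)) => k.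
by rewrite mul1r cos_poly_branch_coef_le.
Qed.

Let speed_term_le n : `|e ^+ n * speed_coef R n| <= 2 * (`|e| * (2 * r)) ^+ n.
Proof.
by apply: (@power_series_term_le R R^o (speed_coef R)) => k; exact: speed_coef_le.
Qed.

Lemma cvg_branch_profile (j : nat) (x : R) : (j <= 3)%N ->
  series (fun n => e ^+ n * cos_poly j (branch_coef R n) x) @ \oo -->
  branch_profile j x.
Proof.
move=> j3; apply: (@cvg_series_geometric R R _ 1 _ q01) => n.
exact: profile_term_le.
Qed.

Lemma is_derive_branch_profile (j : nat) (x : R) : (j <= 1)%N ->
  is_derive x (1 : R) (branch_profile j) (branch_profile j.+1 x).
Proof.
move=> j1.
have j3 k : (k <= 2)%N -> (j + k <= 3)%N by move=> k2; exact: leq_add j1 k2.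
apply: (@is_derive_series R (fun n y => e ^+ n * cos_poly j (branch_coef R n) y)
  (fun n y => e ^+ n * cos_poly j.+1 (branch_coef R n) y)
  (fun n y => e ^+ n * cos_poly j.+2 (branch_coef R n) y)
  (fun n => (`|e| * (2 * r)) ^+ n) (1 - `|e| * (2 * r))^-1).
- by move=> n y; have := is_derive_cos_poly j (branch_coef R n) y => ?; exact: is_derive_eq.
- by move=> n y; have := is_derive_cos_poly j.+1 (branch_coef R n) y => ?; exact: is_derive_eq.
- by move=> n y; rewrite -[leRHS]mul1r profile_term_le// -addn2 j3.
- by move=> N; exact: sum_geometric_le.
- by move=> y; apply: cvg_branch_profile; rewrite -[j]addn0 j3.
- by move=> y; apply: cvg_branch_profile; rewrite -addn1 j3.
Qed.

(** The terms of rank [n.+1] of the left-hand side are those of rank [n] of the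
    Cauchy products on the right, and the term of rank 0 vanishes because [cos]
    is in the kernel. *)
Lemma branch_profile_equation (x : R) :
  branch_profile 2 x + branch_profile 0 x =
  6 * e * (branch_speed * branch_profile 0 x - branch_profile 0 x ^+ 2).
Proof.
pose u j n := e ^+ n * cos_poly j (branch_coef R n) x.
pose m n := e ^+ n * speed_coef R n.
pose conv (a b : nat -> R) n := \sum_(0 <= i < n.+1) a i * b (n - i)%N.
have cu j : (j <= 3)%N -> series (u j) @ \oo --> branch_profile j x.
  exact: cvg_branch_profile.
have cm : series m @ \oo --> branch_speed.
  exact: (@cvg_series_geometric R R _ 2 _ q01).
have u_le n : `|u 0%N n| <= 1 * (`|e| * (2 * r)) ^+ n.
  by apply: profile_term_le.
have lhs : (fun N => series (u 2%N) N + series (u 0%N) N) @ \oo -->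
    branch_profile 2 x + branch_profile 0 x by apply: cvgD; exact: cu.
have rhs : (fun N => 6 * e * (series (conv m (u 0%N)) N -
                              series (conv (u 0%N) (u 0%N)) N)) @ \oo -->
    6 * e * (branch_speed * branch_profile 0 x - branch_profile 0 x ^+ 2).
  apply: cvgM; first exact: cvg_cst.
  apply: cvgB; first exact: (cvg_cauchy_product q01 speed_term_le u_le cm (cu 0%N isT)).
  exact: (cvg_cauchy_product q01 u_le u_le (cu 0%N isT) (cu 0%N isT)).
apply: (cvg_unique _ _ rhs) => //; move: lhs; rewrite -(cvg_shiftn 1).
apply: cvg_trans; apply: near_eq_cvg; apply: nearW => n /=.
rewrite /series/= addn1 -sumrB mulr_sumr -big_split/= big_nat_recl//=.
rewrite /u expr0 !mul1r branch_coef0_equation add0r; apply: eq_bigr => k _.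
rewrite -mulrDr branch_coef_equation exprS.
have convE (a b : nat -> R) :
    conv (fun n => e ^+ n * a n) (fun n => e ^+ n * b n) k =
    e ^+ k * \sum_(0 <= i < k.+1) a i * b (k - i)%N.
  rewrite mulr_sumr; apply: eq_big_nat => i /andP[_]; rewrite ltnS => ik.
  by rewrite -{3}(subnKC ik) exprD; ring.
by rewrite /m !convE; ring.
Qed.

(** With [mu = 5/6 + e * M] the coefficient [1 - mu] is [1/6 - e * M], and the
    equation for [e * U] is [e / 6] times the one for [U]. *)
Lemma kdv_solution_branch :
  kdv_solution (fun x => e * branch_profile 0 x : R^o) (5 / 6 + e * branch_speed).
Proof.
have d1 (x : R) : is_derive x (1 : R) (fun y => e * branch_profile 0 y)
    (e * branch_profile 1 x).
  by have := @is_derive_branch_profile 0 x isT => ?; exact: is_derive_eq.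
have d2 (x : R) : is_derive x (1 : R) (fun y => e * branch_profile 1 y)
    (e * branch_profile 2 x).
  by have := @is_derive_branch_profile 1 x isT => ?; exact: is_derive_eq.
have E1 : (fun y => e * branch_profile 0 y : R^o)^`()%classic =
          (fun y => e * branch_profile 1 y).
  by apply/funext => y; rewrite derive1E; exact: derive_val.
split=> [x|x]; first by rewrite /branch_profile; under eq_fun do rewrite cos_poly_periodic.
split.
- exact: (@ex_derive _ _ _ _ _ _ _ (d1 x)).
- rewrite E1; exact: (@ex_derive _ _ _ _ _ _ _ (d2 x)).
rewrite /derive1n/= E1 derive1E (@derive_val _ _ _ _ _ _ _ (d2 x)).
have := branch_profile_equation x; set u := branch_profile 0 x => eqn.
have -> : branch_profile 2 x = 6 * e * (branch_speed * u - u ^+ 2) - u.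
  by rewrite -eqn addrK.
by field.
Qed.

End branch.

Theorem corollary3p4 (R : realType) (alpha : R)
    (alpha_gt : 1 / 2 < alpha) (alpha_lt : alpha < 1) :
  exists (phi : R -> holder_even alpha) (mu : R -> R) (delta : R),
    [/\ 0 < delta,
        phi 0 = 0 /\ mu 0 = 5 / 6,
        forall e : R, `|e| < delta ->
          analytic_at
            (fun s : R => (phi s, mu s) : (holder_even alpha * R^o)%type) e,
        forall e : R, `|e| < delta ->
          [/\ 0 < mu e, kdv_solution (phi e) (mu e) & e != 0 -> phi e != 0] &
        derivable phi 0 1 /\ (phi^`()%classic 0 : R -> R) = cos].
Proof.
have [r r_ge] : exists r : R, 432 <= r by exists 432.
pose g := 2 * r; have g1 : 1 <= g by rewrite /g; lra.
have g0 : 0 < g by rewrite (lt_le_trans _ g1).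
have gn1 n : 1 <= g ^+ n by rewrite exprn_ege1.
have /choice[H HP] n : exists F : holder_even alpha,
    (forall x, F x = cos_poly 0 (branch_coef R n) x) /\ `|F| <= 4 * g ^+ n.
  have -> : 4 * g ^+ n = 3 * g ^+ n + g ^+ n by ring.
  apply: (@holder_even_of_derive R alpha (g ^+ n) (g ^+ n) _
    (cos_poly 1 (branch_coef R n))).
  - by lra.
  - by lra.
  - exact: cos_poly_even.
  - exact: cos_poly_periodic.
  - by move=> x; exact: is_derive_cos_poly.
  - by move=> x; exact: cos_poly_branch_coef_le.
  - by move=> x; exact: cos_poly_branch_coef_le.
have HE n x := (HP n).1 x; have H_le n := (HP n).2.
have H0 : (H 0%N : R -> R) = cos.
  by apply/funext => x; rewrite HE; exact: cos_polyX.
pose c n : holder_even alpha := if n is k.+1 then H k else 0.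
pose d n : R := if n is k.+1 then speed_coef R k else 5 / 6.
have cS n : `|c n.+1| <= 4 * g ^+ n by exact: H_le.
have dS n : `|d n.+1| <= 4 * g ^+ n.
  by have := speed_coef_le n r_ge; rewrite -/g /= => dn; have := gn1 n; lra.
have c_le n : `|c n| <= 4 * g ^+ n.
  case: n => [|n]; first by rewrite normr0 mulr_ge0// exprn_ge0// ltW.
  by apply: le_trans (cS n) _; rewrite ler_wpM2l// ler_weXn2l.
have d_le n : `|d n| <= 4 * g ^+ n.
  case: n => [|n]; first by rewrite expr0 /d ger0_norm; lra.
  by apply: le_trans (dS n) _; rewrite ler_wpM2l// ler_weXn2l.
(* The quadratic error [8 * (e * g) ^+ 2] then stays below half of [`|e|], which
   separates [phi e] from 0 and keeps [mu e] near [5 / 6]. *)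
pose delta := (16 * g ^+ 2)^-1.
have g20 : 0 < 16 * g ^+ 2 by rewrite mulr_gt0// exprn_gt0.
have delta0 : 0 < delta by rewrite invr_gt0.
have small (e : R) : `|e| < delta -> 16 * (`|e| * g) * g < 1.
  rewrite /delta -[X in _ < X]mul1r ltr_pdivlMr//.
  by rewrite [X in X < _](_ : _ = 16 * (`|e| * g) * g)//; ring.
have eg0 (e : R) : 0 <= `|e| * g by rewrite mulr_ge0// ltW.
have small1 (e : R) : `|e| < delta -> 16 * (`|e| * g) < 1.
  by move=> /small; have := eg0 e; nra.
have small2 (e : R) : `|e| < delta -> 16 * `|e| < 1.
  by move=> /small1; have := normr_ge0 e; nra.
have half (e : R) : `|e| < delta -> `|e| * g <= 1 / 2 by move=> /small1 ?; lra.
have eg1 (e : R) : `|e| < delta -> `|e| * g < 1 by move=> /small1 ?; lra.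
have delta_0 : `|0 : R| < delta by rewrite normr0.
have phiE (e : R) : `|e| < delta -> power_series c e = e *: power_series H e.
  by move=> /eg1; move/(power_series_shift cS (ltW g0)) => ->; rewrite add0r.
have muE (e : R) : `|e| < delta -> power_series d e = 5 / 6 + e * branch_speed e.
  by move=> /eg1; move/(power_series_shift dS (ltW g0)) => ->.
have phi0 : power_series c 0 = 0 by rewrite phiE// scale0r.
exists (power_series c), (power_series d), delta; split => //.
- by split=> //; rewrite muE// mul0r addr0.
- by move=> e /eg1; exact: analytic_at_power_series_pair.
- move=> e ed; split.
  + have := power_series_affine_approx d_le (ltW g0) (half _ ed).
    have := speed_coef_le 0 r_ge; rewrite expr0 mulr1 /d.
    rewrite -[e *: _]/(e * _) => s0.
    have : `|e * speed_coef R 0| <= `|e| * 2 by rewrite normrM ler_wpM2l.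
    rewrite !ler_norml => /andP[s1 _] /andP[s2 _].
    have := eg0 e; have := small1 _ ed; have := small2 _ ed.
    by nra.
  + rewrite muE//.
    suff -> : (power_series c e : R -> R^o) = (fun x => e * branch_profile e 0 x).
      exact: kdv_solution_branch r_ge (eg1 _ ed).
    apply/funext => x; rewrite phiE//.
    change (e * (power_series H e x) = e * branch_profile e 0 x); congr (_ * _).
    have := @cvg_series_eval _ _ x _ _ (cvg_power_series H_le (ltW g0) (eg1 _ ed)).
    move=> /(cvg_lim (@Rhausdorff R)) <-; congr (limn (series _)).
    by apply/funext => n; rewrite -HE.
  + move=> e0; apply/eqP => phie.
    have := power_series_affine_approx c_le (ltW g0) (half _ ed).
    rewrite phie /c subr0 sub0r normrN normrZ.
    have H01 : 1 <= `|H 0%N|.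
      by have := @holder_even_norm_ge _ _ 0 (H 0%N); rewrite H0 cos0 normr1.
    have e0' : 0 < `|e| by rewrite normr_gt0.
    have eH : `|e| <= `|e| * `|H 0%N| by rewrite ler_peMr.
    have := small _ ed => s1 s2.
    have : 16 * (`|e| * g) * g * `|e| < `|e| by rewrite gtr_pMl.
    by nra.
have dphi : is_derive (0 : R) (1 : R) (power_series c) (H 0%N).
  apply: (@is_derive_quadratic _ _ _ _ _ (2 * 4 * g ^+ 2) delta) => // h hd.
  rewrite add0r phi0 subr0.
  have := power_series_affine_approx c_le (ltW g0) (half _ hd).
  by rewrite /c subr0 exprMn [`|h| ^+ 2 * _]mulrC mulrA.
split; first exact: (@ex_derive _ _ _ _ _ _ _ dphi).
by rewrite derive1E (@derive_val _ _ _ _ _ _ _ dphi).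
Qed.
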